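(* Let $X$ be a geodesic space, $C\subseteq X$ a convex subset, $T:C\to C$ a nonexpansive mapping, $u,x_0\in C$, and $(\lambda_n)_{n\ge 1}$ a sequence in $[0,1]$. Define $(x_n)_{n\ge 0}$ by $x_{n+1}=T(\lambda_{n+1}u+(1-\lambda_{n+1})x_n)$ for $n\ge 0$, and define $(y_n)_{n\ge 1}$ by $y_{n+1}=\lambda_{n+1}u+(1-\lambda_{n+1})x_n$ for $n\ge 0$. Let $\Phi:(0,\infty)\to\mathbb{N}$. If $(y_n)_{n\ge 1}$ is asymptotically regular with rate $\Phi$, then $(x_n)_{n\ge 1}$ is asymptotically regular with the same rate $\Phi$.
   Context: A geodesic space is a metric space $(X,d)$ in which any two points are joined by a geodesic segment. For every pair of points $x,y\in X$ a geodesic segment joining them is fixed (when it is unique, it is that one), and for $\lambda\in[0,1]$ the notation $\lambda x+(1-\lambda)y$ denotes the point $z$ on this segment with $d(x,z)=(1-\lambda)d(x,y)$ and $d(y,z)=\lambda d(x,y)$; thus $\lambda x+(1-\lambda)y$ is determined by $(\lambda,x,y)$. A subset $C\subseteq X$ is convex if every geodesic segment joining two points of $C$ is contained in $C$. A mapping $T:C\to C$ is nonexpansive if $d(Tx,Ty)\le d(x,y)$ for all $x,y\in C$. A sequence $(z_n)_{n\ge 1}$ is asymptotically regular if $\lim_{n\to\infty}d(z_n,z_{n+1})=0$. A mapping $\Phi:(0,\infty)\to\mathbb{N}$ is a rate of asymptotic regularity for $(z_n)_{n\ge 1}$ if for all $\varepsilon>0$ and all $n\ge 1$ with $n\ge\Phi(\varepsilon)$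 one has $d(z_n,z_{n+1})<\varepsilon$; in this case $(z_n)$ is said to be asymptotically regular with rate $\Phi$. *)

(* Defs.v *)
From HB Require Import structures.
From mathcomp Require Import all_boot all_order all_algebra.
From mathcomp Require Import all_classical all_reals all_analysis.

Set Implicit Arguments.
Unset Strict Implicit.
Unset Printing Implicit Defensive.

Import Order.TTheory GRing.Theory Num.Theory.
Import numFieldNormedType.Exports.

Local Open Scope classical_set_scope.
Local Open Scope ring_scope.

Section Geodesic.
Context {R : realType} {X : metricType R}.

(* gamma is an isometric embedding of [0, d(x,y)]; only its values on that
   interval are relevant *)
Definition geodesic_path (x y : X) (gamma : R -> X) : Prop :=
  [/\ gamma 0 = x, gamma (mdist x y) = y &
      forall s t : R, 0 <= s <= mdist x y -> 0 <= t <= mdist x y ->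
        mdist (gamma s) (gamma t) = `|s - t| ].

Definition geodesic_segment (x y : X) (S : set X) : Prop :=
  exists2 gamma : R -> X,
    geodesic_path x y gamma & S = gamma @` `[0, mdist x y].

Definition geodesically_convex (C : set X) : Prop :=
  forall (x y : X) (S : set X), C x -> C y -> geodesic_segment x y S ->
    S `<=` C.

(* seg fixes one geodesic segment for each ordered pair of points;
   seg x y and seg y x may differ *)
Definition segment_choice (seg : X -> X -> set X) : Prop :=
  forall x y : X, geodesic_segment x y (seg x y).

(* lambda x + (1 - lambda) y. The default value x of xget is never used when
   seg is a segment choice and lambda is in [0, 1]: see conv_combP, and
   conv_comb_uniq for uniqueness of the point. *)
Definition conv_comb (seg : X -> X -> set X) (lambda : R) (x y : X) : X :=
  xget x [set z | [/\ seg x y z, mdist x z = (1 - lambda) * mdist x y &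
                      mdist y z = lambda * mdist x y]].

Lemma geodesic_path_dist (x y : X) (g : R -> X) (t : R) :
  geodesic_path x y g -> 0 <= t <= mdist x y ->
  mdist x (g t) = t /\ mdist y (g t) = mdist x y - t.
Proof.
move=> [g0 g1 gd] tI; have d0 := mdist_ge0 x y; case/andP: (tI) => t0 t1.
have := gd 0 t; have := gd (mdist x y) t.
rewrite g0 g1 !lexx !d0 => -> // -> //.
by rewrite sub0r normrN !ger0_norm // subr_ge0.
Qed.

Lemma conv_combP (seg : X -> X -> set X) (lambda : R) (x y : X) :
  segment_choice seg -> 0 <= lambda <= 1 ->
  [/\ seg x y (conv_comb seg lambda x y),
      mdist x (conv_comb seg lambda x y) = (1 - lambda) * mdist x y &
      mdist y (conv_comb seg lambda x y) = lambda * mdist x y].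
Proof.
move=> hseg /andP[l0 l1]; have [g gP gS] := hseg x y.
have d0 := mdist_ge0 x y.
have tI : 0 <= (1 - lambda) * mdist x y <= mdist x y.
  by rewrite mulr_ge0 ?subr_ge0 //= ler_piMl // gerBl.
have [dx dy] := geodesic_path_dist gP tI.
rewrite /conv_comb; case: xgetP => [z _ //|noz].
case: (noz (g ((1 - lambda) * mdist x y))); split=> //.
- by rewrite gS; exists ((1 - lambda) * mdist x y); rewrite //= in_itv.
- by rewrite dy mulrBl mul1r opprB addrC subrK.
Qed.

Lemma conv_comb_uniq (seg : X -> X -> set X) (lambda : R) (x y z : X) :
  segment_choice seg -> 0 <= lambda <= 1 -> seg x y z ->
  mdist x z = (1 - lambda) * mdist x y -> z = conv_comb seg lambda x y.
Proof.
move=> hseg hl sz dz; have [sw dw _] := conv_combP x y hseg hl.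
have [g gP gS] := hseg x y.
have key w : seg x y w -> w = g (mdist x w).
  rewrite gS => -[t]; rewrite /= in_itv /= => tI <-.
  by rewrite (geodesic_path_dist gP tI).1.
by rewrite (key _ sz) (key _ sw) dz dw.
Qed.

Definition nonexpansive_on (C : set X) (T : X -> X) : Prop :=
  forall x y : X, C x -> C y -> mdist (T x) (T y) <= mdist x y.

(* the sequence is (z_n)_{n >= 1}: z 0 plays no role *)
Definition asymptotically_regular_with_rate
    (z : nat -> X) (Phi : {posnum R} -> nat) : Prop :=
  forall (eps : {posnum R}) (n : nat), (1 <= n)%N -> (Phi eps <= n)%N ->
    mdist (z n) (z n.+1) < eps%:num.

End Geodesic.

Definition geodesic_space {R : realType} (X : metricType R) : Prop :=
  forall x y : X, exists S : set X, geodesic_segment x y S.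

(* Main.v *)
Require Import Defs.
From HB Require Import structures.
From mathcomp Require Import all_boot all_order all_algebra.
From mathcomp Require Import all_classical all_reals all_analysis.

Import Order.TTheory GRing.Theory Num.Theory.
Import numFieldNormedType.Exports.

Local Open Scope classical_set_scope.
Local Open Scope ring_scope.

(** For [n >= 1] both sequences come from the same convex combination, so [x n = T (y n)].
    Nonexpansiveness then bounds the distance of consecutive terms of [x] by that of [y], and the
    rate carries over unchanged. What needs checking is that the [y n] lie in [C], which is
    [conv_comb_convex] together with an induction along [x]. *)

(** By [conv_combP] the point lies on the chosen segment, which is geodesic with endpoints in
    [C]. *)
Lemma conv_comb_convex (R : realType) (X : metricType R)
    (seg : X -> X -> set X) (C : set X) (lambda : R) (x y : X) :
  segment_choice seg -> geodesically_convex C -> 0 <= lambda <= 1 ->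
  C x -> C y -> C (conv_comb seg lambda x y).
Proof.
move=> hseg hC hl Cx Cy; have [sz _ _] := conv_combP x y hseg hl.
exact: hC Cx Cy (hseg x y) _ sz.
Qed.

Theorem mainTheorem3 (R : realType) (X : metricType R)
    (hX : geodesic_space X)
    (seg : X -> X -> set X) (hseg : segment_choice seg)
    (C : set X) (hC : geodesically_convex C)
    (T : {fun C >-> C}) (hT : nonexpansive_on C T)
    (u x0 : X) (hu : C u) (hx0 : C x0)
    (lambda : nat -> R)
    (hlambda : forall n : nat, (1 <= n)%N -> 0 <= lambda n <= 1)
    (x y : nat -> X)
    (hx_init : x 0%N = x0)
    (hx : forall n : nat,
        x n.+1 = T (conv_comb seg (lambda n.+1) u (x n)))
    (hy : forall n : nat,
        y n.+1 = conv_comb seg (lambda n.+1) u (x n))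
    (Phi : {posnum R} -> nat) :
  asymptotically_regular_with_rate y Phi ->
  asymptotically_regular_with_rate x Phi.
Proof.
(* Excluding index 0 matters: [y 0] is arbitrary, and [x 0] need not be a value of [T]. *)
move=> hreg eps [//|n] _ hn.
have Cx m : C (x m).
  elim: m => [|m IHm]; first by rewrite hx_init.
  by rewrite hx; apply: funS; apply: conv_comb_convex => //; exact: hlambda.
have Cy m : C (y m.+1).
  by rewrite hy; apply: conv_comb_convex => //; exact: hlambda.
have xTy m : x m.+1 = T (y m.+1) by rewrite hx hy.
rewrite !xTy; apply: le_lt_trans (hT _ _ (Cy _) (Cy _)) _.
exact: hreg.
Qed.
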